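(* Let $G$ be a connected non-complete graph of order $n\geq 25$. If $C(G)$ is a linear forest and $\delta(G)\geq \frac{n-4}{5}$, then $cfc(G) = 2$.
   Context: All graphs are finite, simple and undirected; $\delta(G)$ is the minimum degree. For a graph $G$, $C(G)$ denotes the subgraph of $G$ induced by the set of cut-edges of $G$. A linear forest is a forest each of whose components is a path (an edgeless graph counts). An edge-coloring of a connected graph (adjacent edges may receive the same color) is a conflict-free connection coloring if every pair of distinct vertices is joined by a path containing at least one color used on exactly one edge of that path. The conflict-free connection number $cfc(G)$ is the smallest number of colors in a conflict-free connection coloring of $G$. *)

(* Defs.v *)
From mathcomp Require Import all_boot.

Set Implicit Arguments.
Unset Strict Implicit.
Unset Printing Implicit Defensive.

Record sgraph := SGraph {
  vertex :> finType;
  adj : rel vertex;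
  adj_sym : symmetric adj;
  adj_irr : irreflexive adj }.

Section Graphs.
Variable G : sgraph.
Implicit Types (x y u v : G) (E : {set G}) (F : {set {set G}}).

Definition connected := forall x y, connect (@adj G) x y.

Definition complete := forall x y, x != y -> adj x y.

Definition degree x := #|[set y | adj x y]|.

(* Every degree is at most #|G|, so the default value of the iterated minimum
   does not affect the result on a nonempty graph. *)
Definition min_degree := \big[minn/#|G|]_(x : G) degree x.

Definition edges : {set {set G}} :=
  [set [set p.1; p.2] | p : G * G & adj p.1 p.2].

Definition del_rel E := [rel u v | adj u v && ([set u; v] != E)].

Lemma del_sym E : symmetric (del_rel E).
Proof. by move=> u v; rewrite /= adj_sym setUC. Qed.

Lemma del_irr E : irreflexive (del_rel E).
Proof. by move=> u; rewrite /= adj_irr. Qed.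

Definition del_edge E : sgraph := SGraph (del_sym E) (del_irr E).

(* Subgraph induced by a set F of edges: its vertices are the endpoints of the
   edges in F. *)
Definition einduced_rel F : rel {x : G | x \in cover F} :=
  [rel u v | adj (val u) (val v) && ([set val u; val v] \in F)].

Lemma einduced_sym F : symmetric (@einduced_rel F).
Proof. by move=> u v; rewrite /einduced_rel /= adj_sym setUC. Qed.

Lemma einduced_irr F : irreflexive (@einduced_rel F).
Proof. by move=> u; rewrite /einduced_rel /= adj_irr. Qed.

Definition edge_induced F : sgraph :=
  SGraph (@einduced_sym F) (@einduced_irr F).

Definition forest := forall s : seq G, 2 < size s -> ~~ ucycleb (@adj G) s.

(* s lists the vertices of the component of x in order along the path. *)
Definition path_component x := exists s : seq G,
  [/\ uniq s,
      s =i connect (@adj G) x &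
      {in s &, forall u v, adj u v =
         (index v s == (index u s).+1) || (index u s == (index v s).+1)}].

Definition linear_forest := forest /\ forall x, path_component x.

(* The path visits x and then the vertices of p in order. *)
Definition is_path x y (p : seq G) :=
  [/\ path (@adj G) x p, uniq (x :: p) & last x p = y].

Definition path_edges x (p : seq G) : seq {set G} :=
  pairmap (fun u v => [set u; v]) x p.

(* A coloring is a function on all sets of vertices; only its values on
   [edges] matter. *)
Definition conflict_free_path (c : {set G} -> nat) x (p : seq G) :=
  exists k, count_mem k [seq c E | E <- path_edges x p] = 1.

Definition cfc_coloring (c : {set G} -> nat) := forall x y, x != y ->
  exists p, is_path x y p /\ conflict_free_path c x p.

Definition num_colors (c : {set G} -> nat) :=
  size (undup [seq c E | E in edges]).

(* cfc(G) = k *)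
Definition cfc_number_is k :=
  (exists c, cfc_coloring c /\ num_colors c = k) /\
  (forall c, cfc_coloring c -> k <= num_colors c).

End Graphs.

Definition num_components (G : sgraph) := n_comp (@adj G) predT.

Definition cut_edges (G : sgraph) : {set {set G}} :=
  [set E in edges G | num_components G < num_components (del_edge E)].

Definition cut_subgraph (G : sgraph) : sgraph := edge_induced (cut_edges G).

(* Main.v *)
Require Import Defs.
From mathcomp Require Import all_boot all_order all_algebra.
From mathcomp Require Import zify.

(** Take a minimal connected spanning set [T] of edges and colour the edges
outside [T] with 1, those of [T] with 0.  If the path of [T] from [x] to [y]
uses an edge [f] that is not a cut-edge, then some chord outside [T] joins the
two components of [T - f], and rerouting through this chord gives a path from
[x] to [y] with exactly one edge of colour 1.  Finally give colour 1 to one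
cut-edge [b] as well.  A path of [T] through [b] now has exactly one edge of
colour 1; the reroutings of paths that avoid [b] still have exactly one; and a
path of [T] made of cut-edges other than [b] is a single edge, provided that
these are pairwise disjoint.

Such an edge [b] exists among at most three cut-edges, since no three edges of a
linear forest meet pairwise.  Four cut-edges are impossible: at least [delta]
edges leave any nonempty set of at most [delta] vertices, so for [delta >= 5]
the deletion of four cut-edges leaves five components with more than [delta]
vertices each, whereas [n < 5 (delta + 1)]. *)

Set Implicit Arguments.
Unset Strict Implicit.
Unset Printing Implicit Defensive.

Section DisjointFamilies.
Variable T : finType.
Implicit Types (A B C : {set T}) (P Q : {set {set T}}).

Lemma card_le1_trivIset P : #|P| <= 1 -> trivIset P.
Proof.
move=> /card_le1_eqP eq_inP; apply/trivIsetP => A B /eq_inP/[apply]->.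
by rewrite eqxx.
Qed.

Lemma trivIset_set2 A B : [disjoint A & B] -> trivIset [set A; B].
Proof.
move=> disAB; apply/trivIsetP => C D /set2P[]-> /set2P[]->; rewrite ?eqxx //.
by rewrite disjoint_sym.
Qed.

Lemma trivIset_delete_le1 P : #|P| <= 3 ->
    (forall A B C, [/\ A \in P, B \in P & C \in P] ->
       [/\ A != B, B != C & C != A] ->
       [|| [disjoint A & B], [disjoint B & C] | [disjoint C & A]]) ->
  exists Q, [/\ Q \subset P, #|Q| <= 1 & trivIset (P :\: Q)].
Proof.
move=> leP3 dis3; have [/card_gt2P|leP2] := ltnP 2 #|P|; last first.
  have [->|/set0Pn[A PA]] := eqVneq P set0.
    by exists set0; rewrite sub0set cards0 setD0 card_le1_trivIset ?cards0.
  exists [set A]; rewrite sub1set cards1; split=> //; apply: card_le1_trivIset.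
  by move: leP2; rewrite (cardsD1 A) PA.
case=> A [B] [C] [inP neq].
have [[PA PB PC] [neqAB neqBC neqCA]] := (inP, neq).
have delete D A' B' : D \in P -> A' \in P :\ D -> B' \in P :\ D -> A' != B' ->
    [disjoint A' & B'] ->
    exists Q, [/\ Q \subset P, #|Q| <= 1 & trivIset (P :\: Q)].
  move=> PD PA' PB' neqAB' disAB'.
  exists [set D]; rewrite sub1set cards1; split=> //.
  suff <- : [set A'; B'] = P :\ D by apply: trivIset_set2.
  apply/eqP; rewrite eqEcard subUset !sub1set PA' PB' cards2 neqAB' /=.
  by move: leP3; rewrite (cardsD1 D) PD.
case/or3P: (dis3 A B C inP neq).
- by apply: (delete C); rewrite // !inE ?PA ?PB // ?neqBC // eq_sym neqCA.
- by apply: (delete A); rewrite // !inE ?PB ?PC // ?neqCA // eq_sym neqAB.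
- by apply: (delete B); rewrite // !inE ?PA ?PC // ?neqAB // eq_sym neqBC.
Qed.

End DisjointFamilies.

Section Components.
Variables (T : finType) (e : rel T).

Lemma connect_leave (D : {pred T}) x y :
    connect e x y -> x \in D -> y \notin D ->
  exists a b, [/\ e a b, a \in D & b \notin D].
Proof.
move=> /connectP[p xp ->]; elim: p x xp => [|z p IHp] x /=.
  by move=> _ ->.
move=> /andP[xz zp] xD lastND; have [zD|zND] := boolP (z \in D).
  exact: IHp zp zD lastND.
by exists x, z.
Qed.

Hypothesis sym_e : connect_sym e.

Lemma n_comp_gt0 : 0 < #|T| -> 0 < n_comp e predT.
Proof.
move=> /card_gt0P[x _]; apply/card_gt0P; exists (fingraph.root e x).
by rewrite inE roots_root.
Qed.

Lemma n_comp_ltn (e' : rel T) u v : connect_sym e' -> subrel e' e ->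
  connect e u v -> ~~ connect e' u v -> n_comp e predT < n_comp e' predT.
Proof.
move=> sym_e' sub_e conn_uv; apply: contraR; rewrite -leqNgt => le_comp.
have root_root' x : fingraph.root e (fingraph.root e' x) = fingraph.root e x.
  apply/(fingraph.rootP sym_e); rewrite sym_e.
  apply: (connect_sub _ (connect_root e' x)) => y z /sub_e; exact: connect1.
pose roots' := [set x | roots e' x]; pose root_e := fingraph.root e.
have n_comp' : n_comp e' predT = #|roots'|.
  by rewrite cardsE; apply: eq_card => x; rewrite !inE andbT.
have n_comp_image : n_comp e predT <= #|[set root_e x | x in roots']|.
  apply/subset_leq_card/subsetP => x; rewrite !inE andbT => /eqP root_x.
  apply/imsetP; exists (fingraph.root e' x); first by rewrite inE roots_root.
  by rewrite /root_e root_root'.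
have /imset_injP root_inj : #|[set root_e x | x in roots']| == #|roots'|.
  by rewrite eqn_leq leq_imset_card -n_comp' (leq_trans le_comp).
apply/(fingraph.rootP sym_e'); apply: root_inj; rewrite ?inE ?roots_root //.
by rewrite /root_e !root_root'; apply/(fingraph.rootP sym_e).
Qed.

Lemma n_comp_mul_leq k : (forall x, k <= #|connect e x|) ->
  n_comp e predT * k <= #|T|.
Proof.
move=> le_k; rewrite -sum_nat_const -sum1_card.
rewrite [leqRHS](partition_big (fingraph.root e) [in predI (roots e) predT]) /=.
  2: by move=> x _; rewrite !inE roots_root.
apply: leq_sum => x; rewrite !inE andbT => /eqP root_x.
apply: leq_trans (le_k x) _; rewrite -sum1_card; apply: eq_leq.
by apply: eq_bigl => y; rewrite -[LHS](root_connect sym_e) root_x eq_sym.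
Qed.

End Components.

Section EdgeSets.
Variable G : sgraph.
Implicit Types (x y z u v : G) (p q : seq G) (E : {set G}).
Implicit Types F P : {set {set G}}.

Lemma adj_neq u v : adj u v -> u != v.
Proof. by apply: contraTneq => ->; rewrite adj_irr. Qed.

Lemma edgesP E :
  reflect (exists u v, adj u v /\ E = [set u; v]) (E \in edges G).
Proof.
apply: (iffP imsetP) => [[[u v]]|[u [v [uv ->]]]].
  by rewrite inE => /= uv ->; exists u, v.
by exists (u, v); rewrite ?inE.
Qed.

Lemma mem_edges u v : ([set u; v] \in edges G) = adj u v.
Proof.
apply/edgesP/idP => [[a [b [ab eq_uv]]]|]; last by exists u, v.
have : u != v.
  by have := cards2 u v; rewrite eq_uv cards2 adj_neq //; case: (u != v).
have /set2P[->|->] : u \in [set a; b] by rewrite -eq_uv set21.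
  have /set2P[->|->//] : v \in [set a; b] by rewrite -eq_uv set22.
  by rewrite eqxx.
have /set2P[->|->] : v \in [set a; b] by rewrite -eq_uv set22.
  by rewrite adj_sym.
by rewrite eqxx.
Qed.

Definition edge_rel F := [rel u v | adj u v && ([set u; v] \in F)].

Lemma connect_edge_rel_sym F : connect_sym (edge_rel F).
Proof. by apply: sym_connect_sym => u v; rewrite /= adj_sym setUC. Qed.

Lemma connect_edge_relS F F' x y : F \subset F' ->
  connect (edge_rel F) x y -> connect (edge_rel F') x y.
Proof.
move=> /subsetP sFF'; apply: connect_sub => u v /andP[uv /sFF' uvF'].
by apply: connect1; rewrite /= uv.
Qed.

Lemma connect_edge_relT x y :
  connect (edge_rel setT) x y = connect (@adj G) x y.
Proof. by apply: eq_connect => u v; rewrite /= inE andbT. Qed.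

Lemma path_edge_rel F x p :
  path (edge_rel F) x p = path (@adj G) x p && all [in F] (path_edges x p).
Proof. by elim: p x => //= y p IHp x; rewrite IHp andbACA. Qed.

Lemma path_edges_cat x p q :
  path_edges x (p ++ q) = path_edges x p ++ path_edges (last x p) q.
Proof. exact: pairmap_cat. Qed.

Lemma path_edges_sub x p : path (@adj G) x p ->
  {subset path_edges x p <= edges G}.
Proof.
elim: p x => //= y p IHp x /andP[xy yp] E; rewrite inE => /orP[/eqP->|].
  by rewrite mem_edges.
exact: IHp.
Qed.

Lemma mem_path_of_edge x p E u :
  E \in path_edges x p -> u \in E -> u \in x :: p.
Proof.
elim: p x => //= y p IHp x; rewrite inE => /orP[/eqP-> /set2P[]->|Ep uE].
- exact: mem_head.
- by rewrite !inE eqxx orbT.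
- by rewrite in_cons (IHp y Ep uE) orbT.
Qed.

Lemma path_edges_uniq x p : uniq (x :: p) -> uniq (path_edges x p).
Proof.
elim: p x => //= y p IHp x /andP[xNyp up]; rewrite IHp // andbT.
by apply: contra xNyp => /mem_path_of_edge; apply; apply: set21.
Qed.

Lemma connect_edge_relP F x y :
  reflect (exists2 p, is_path x y p & {subset path_edges x p <= F})
          (connect (edge_rel F) x y).
Proof.
apply: (iffP connectP) => [[s path_s ->]|[p [xp _ <-] /allP pF]]; last first.
  by exists p; rewrite // path_edge_rel xp.
case/shortenP: path_s => p; rewrite path_edge_rel => /andP[xp /allP pF] up _.
by exists p.
Qed.

Lemma connect_edge_rel_mem_path F x y p z : is_path x y p ->
  {subset path_edges x p <= F} -> z \in x :: p -> connect (edge_rel F) x z.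
Proof.
move=> [xp _ _] /allP pF; apply: path_connect.
by rewrite path_edge_rel xp.
Qed.

Lemma path_split_at_edge F E x y p : is_path x y p ->
    {subset path_edges x p <= F} -> E \in path_edges x p ->
  exists u v, [/\ E = [set u; v], connect (edge_rel (F :\ E)) x u &
                  connect (edge_rel (F :\ E)) v y].
Proof.
elim: p x => // z p IHp x [/andP[xz zp] up last_p] pF.
have z_path : is_path z y p by split=> //; case/andP: up.
have zpF : {subset path_edges z p <= F}.
  by move=> E' E'p; apply: pF; rewrite inE E'p orbT.
have /andP[xzNp _] := path_edges_uniq up.
rewrite inE; have [->|neqE] := eqVneq E [set x; z] => /= [_|Ep].
  exists x, z; split=> //; apply/connect_edge_relP; exists p => // E' E'p.
  by rewrite !inE zpF // andbT; apply: contraNneq xzNp => <-.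
have [u [v [defE zu vy]]] := IHp z z_path zpF Ep.
exists u, v; split=> //; apply: connect_trans zu; apply: connect1.
by rewrite /= xz !inE eq_sym neqE pF // mem_head.
Qed.

Lemma connect_edge_rel_delete F E x y : connect (edge_rel F) x y ->
  connect (edge_rel (F :\ E)) x y \/
  exists u v, [/\ E = [set u; v], connect (edge_rel (F :\ E)) x u &
                  connect (edge_rel (F :\ E)) v y].
Proof.
move=> /connect_edge_relP[p p_path pF].
have [Ep|ENp] := boolP (E \in path_edges x p).
  by right; apply: path_split_at_edge p_path pF Ep.
left; apply/connect_edge_relP; exists p => // E' E'p.
by rewrite !inE pF // andbT; apply: contraNneq ENp => <-.
Qed.

Lemma eq_connect_edge_rel_delete F u v :
  connect (edge_rel (F :\ [set u; v])) u v ->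
  connect (edge_rel (F :\ [set u; v])) =2 connect (edge_rel F).
Proof.
set F' := F :\ _ => uv x y; apply/idP/idP.
  exact/connect_edge_relS/subD1set.
move=> /(connect_edge_rel_delete [set u; v])[//|[a [b [eq_ab xa yb]]]].
apply: connect_trans xa _; apply: connect_trans yb.
have /set2P[->|->] : a \in [set u; v] by rewrite eq_ab set21.
  have /set2P[->|->] : b \in [set u; v] by rewrite eq_ab set22.
    exact: connect0.
  exact: uv.
have /set2P[->|->] : b \in [set u; v] by rewrite eq_ab set22.
  by rewrite connect_edge_rel_sym.
exact: connect0.
Qed.

Lemma is_path_cat_edge x a b y p q :
  is_path x a p -> adj a b -> is_path b y q ->
  ~~ has [in x :: p] (b :: q) -> is_path x y (p ++ b :: q).
Proof.
move=> [xp up pa] ab [bq uq qy] dis; split; last by rewrite last_cat.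
  by rewrite cat_path xp pa /= ab.
by rewrite -cat_cons cat_uniq up dis.
Qed.

Lemma trivIset_path_size P x p : trivIset P -> path (@adj G) x p ->
  uniq (x :: p) -> {subset path_edges x p <= P} -> size p <= 1.
Proof.
case: p => [|a [|b p]] //= /trivIsetP disP _ /andP[xNp _] sub.
have xaP : [set x; a] \in P by apply: sub; rewrite inE eqxx.
have abP : [set a; b] \in P by apply: sub; rewrite !inE eqxx orbT.
have neq : [set x; a] != [set a; b].
  apply: contraNneq xNp => eq_xa; have := set21 x a.
  by rewrite eq_xa => /set2P[]->; rewrite !inE eqxx ?orbT.
by have /pred0P/(_ a) := disP _ _ xaP abP neq; rewrite /= set21 set22.
Qed.

End EdgeSets.

Section CutEdges.
Variable G : sgraph.
Implicit Types (x y u v : G) (p q : seq G) (E K : {set G}) (S : {set {set G}}).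

Lemma mem_cut_edges u v : connected G ->
  ([set u; v] \in cut_edges G) =
    adj u v && ~~ connect (edge_rel [set~ [set u; v]]) u v.
Proof.
move=> G_conn; rewrite inE mem_edges -setTD; set F := setT :\ _.
case: (boolP (adj u v)) => //= uv.
have -> : num_components G = n_comp (@edge_rel G setT) predT.
  by apply: eq_n_comp => x y; rewrite connect_edge_relT.
have -> : num_components (del_edge [set u; v]) = n_comp (edge_rel F) predT.
  by apply/eq_n_comp/eq_connect => x y; rewrite /= !inE andbT.
apply/idP/idP => [|sep_uv]; last first.
  apply: n_comp_ltn sep_uv; try exact: connect_edge_rel_sym.
    by move=> x y /andP[xy _]; rewrite /= xy inE.
  by rewrite connect_edge_relT.
apply: contraL => conn_uv.
by rewrite (eq_n_comp (eq_connect_edge_rel_delete conn_uv)) ltnn.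
Qed.

Lemma cut_edge_on_every_path E x y p q : connected G -> E \in cut_edges G ->
    is_path x y p -> is_path x y q ->
  E \in path_edges x p -> E \in path_edges x q.
Proof.
move=> G_conn cutE p_path q_path Ep; apply: contraT => ENq.
have pT : {subset path_edges x p <= setT} by move=> E' _; rewrite inE.
have [u [v [defE xu vy]]] := path_split_at_edge p_path pT Ep.
have xy : connect (edge_rel [set~ E]) x y.
  apply/connect_edge_relP; exists q => // E' E'q.
  by rewrite !inE; apply: contraNneq ENq => <-.
rewrite setTD connect_edge_rel_sym in xu.
rewrite setTD connect_edge_rel_sym in vy.
move: cutE; rewrite defE mem_cut_edges // -defE => /andP[_ /negP[]].
exact: connect_trans xu (connect_trans xy vy).
Qed.

Lemma n_comp_delete_cut_edges_gt S : connected G -> 0 < #|G| ->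
  S \subset cut_edges G -> #|S| < n_comp (edge_rel (~: S)) predT.
Proof.
move=> G_conn G_gt0; have [m] := ubnP #|S|.
elim: m S => // m IHm S /ltnSE leSm cutS.
have [->|/set0Pn[E SE]] := eqVneq S set0.
  by rewrite cards0 n_comp_gt0 //; apply: connect_edge_rel_sym.
have cardS : #|S| = #|S :\ E|.+1 by rewrite (cardsD1 E) SE.
have lt_delete : #|S :\ E| < n_comp (edge_rel (~: (S :\ E))) predT.
  by apply: IHm; rewrite -?cardS // (subset_trans (subD1set _ _)).
rewrite cardS; apply: leq_ltn_trans lt_delete _.
have /edgesP[u [v [uv defE]]] : E \in edges G.
  by have := subsetP cutS E SE; rewrite inE => /andP[].
apply: (@n_comp_ltn _ _ _ _ u v); try exact: connect_edge_rel_sym.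
- move=> x y /andP[xy]; rewrite inE => xyNS.
  by rewrite /= xy !inE (negPf xyNS) andbF.
- by apply: connect1; rewrite /= uv -defE !inE eqxx.
have := subsetP cutS E SE; rewrite defE mem_cut_edges // => /andP[_].
by apply: contra; apply: connect_edge_relS; rewrite setCS sub1set -defE.
Qed.

Lemma min_degree_le_degree x : min_degree G <= degree x.
Proof.
rewrite /min_degree -Order.NatOrder.minEnat -Order.NatOrder.leEnat.
exact: Order.TotalTheory.bigmin_le.
Qed.

Definition edge_boundary K : {set {set G}} :=
  [set [set p.1; p.2] | p : G * G & [&& p.1 \in K, p.2 \notin K & adj p.1 p.2]].

Lemma card_edge_boundary K :
  #|edge_boundary K| = \sum_(x in K) #|[set y | adj x y] :\: K|.
Proof.
rewrite card_in_imset => [|[a b] [c d]]; last first.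
  rewrite !inE /= => /and3P[aK bNK _] /and3P[cK dNK _] eq_ab.
  have /set2P[<-|ad] : a \in [set c; d] by rewrite -eq_ab set21.
    have /set2P[bc|<-//] : b \in [set c; d] by rewrite -eq_ab set22.
    by rewrite bc cK in bNK.
  by rewrite -ad aK in dNK.
under eq_bigr do rewrite -sum1_card.
rewrite pair_big_dep /= -sum1_card; apply: eq_bigl => -[a b].
by rewrite !inE.
Qed.

(* Each of the k <= delta vertices of K has at least delta - (k - 1) neighbours
   outside K, and k (delta - k + 1) >= delta. *)
Lemma min_degree_le_card_boundary K :
  0 < #|K| <= min_degree G -> min_degree G <= #|edge_boundary K|.
Proof.
move=> /andP[K_gt0 K_le]; rewrite card_edge_boundary.
have outside x : x \in K ->
    (min_degree G).+1 - #|K| <= #|[set y | adj x y] :\: K|.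
  move=> xK; have inside : #|[set y | adj x y] :&: K| <= #|K :\ x|.
    apply/subset_leq_card/subsetP => y; rewrite !inE => /andP[xy ->].
    by rewrite eq_sym adj_neq.
  have := min_degree_le_degree x; rewrite /degree -(cardsID K).
  by move: inside; rewrite (cardsD1 x K) xK; lia.
apply: (@leq_trans (\sum_(x in K) ((min_degree G).+1 - #|K|))).
  rewrite sum_nat_const; nia.
exact: leq_sum.
Qed.

Lemma edge_boundary_component S x :
  edge_boundary [set y | connect (edge_rel (~: S)) x y] \subset S.
Proof.
apply/subsetP => E /imsetP[[a b]]; rewrite !inE /= => /and3P[xa xNb ab] ->.
apply: contraR xNb => abNS; apply: connect_trans xa (connect1 _).
by rewrite /= ab inE.
Qed.

Lemma card_component_gt_min_degree S x : #|S| < min_degree G ->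
  min_degree G < #|connect (edge_rel (~: S)) x|.
Proof.
move=> ltS; rewrite -cardsE ltnNge; apply/negP => leK.
have : min_degree G <= #|S|; last by rewrite leqNgt ltS.
apply: leq_trans (subset_leq_card (edge_boundary_component S x)).
apply: min_degree_le_card_boundary; rewrite leK andbT.
by apply/card_gt0P; exists x; rewrite inE connect0.
Qed.

Lemma card_cut_edges_lt k : connected G -> 0 < #|G| -> k < min_degree G ->
  #|G| < k.+1 * (min_degree G).+1 -> #|cut_edges G| < k.
Proof.
move=> G_conn G_gt0 ltk; apply: contraTT; rewrite -!leqNgt => /card_geqP[s].
case=> s_uniq s_size s_cut; pose S := [set E in s].
have cardS : #|S| = k by rewrite cardsE (card_uniqP s_uniq).
have cutS : S \subset cut_edges G by apply/subsetP => E; rewrite inE => /s_cut.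
have ltS : #|S| < min_degree G by rewrite cardS.
have large x := card_component_gt_min_degree x ltS.
apply: leq_trans (n_comp_mul_leq (connect_edge_rel_sym _) large).
by rewrite leq_mul2r -cardS n_comp_delete_cut_edges_gt ?orbT.
Qed.

End CutEdges.

Lemma path_component_edge (H : sgraph) (s : seq H) x y E :
    s =i connect (@adj H) x ->
    {in s &, forall u v, adj u v =
       (index v s == (index u s).+1) || (index u s == (index v s).+1)} ->
    E \in edges H -> y \in E -> y \in s ->
  exists2 i, i.+1 < size s & E = [set nth x s i; nth x s i.+1].
Proof.
move=> s_comp s_adj /edgesP[a [b [ab ->]]] yE ys.
have ab_s : (a \in s) = (b \in s).
  rewrite !s_comp; apply: connect_closed ab.
  exact: sym_connect_sym (@adj_sym H).
have [sa sb] : a \in s /\ b \in s.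
  by case/set2P: yE ys ab_s => -> -> => [<-|->].
have consecutive u v : u \in s -> v \in s -> index v s = (index u s).+1 ->
    exists2 i, i.+1 < size s & [set u; v] = [set nth x s i; nth x s i.+1].
  move=> su sv uv; exists (index u s); rewrite -uv ?index_mem //.
  by rewrite !nth_index.
move: ab; rewrite s_adj // => /orP[]/eqP; first exact: consecutive.
by rewrite setUC; apply: consecutive.
Qed.

(* Numbering the vertices of a component along its path, three pairwise meeting
   edges {i, i+1}, {j, j+1}, {k, k+1} have indices within 1 of each other, hence
   two of them coincide. *)
Lemma linear_forest_disjoint_pair (H : sgraph) (E1 E2 E3 : {set H}) :
    linear_forest H -> [/\ E1 \in edges H, E2 \in edges H & E3 \in edges H] ->
    [/\ E1 != E2, E2 != E3 & E3 != E1] ->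
  [|| [disjoint E1 & E2], [disjoint E2 & E3] | [disjoint E3 & E1]].
Proof.
move=> [_ path_comp] [HE1 HE2 HE3] [neq12 neq23 neq31]; apply: contraT.
rewrite !negb_or -!setI_eq0 => /and3P[/set0Pn[u] + /set0Pn[v] + /set0Pn[w]].
move=> /setIP[u1 u2] /setIP[v2 v3] /setIP[w3 w1].
have [s [s_uniq s_comp s_adj]] := path_comp u.
have position := path_component_edge s_comp s_adj.
have us : u \in s by rewrite s_comp; apply: connect0.
have [i si defE1] := position u E1 HE1 u1 us.
have [j sj defE2] := position u E2 HE2 u2 us.
have vs : v \in s.
  by move: v2; rewrite defE2 => /set2P[]->; rewrite mem_nth // ltnW.
have [k sk defE3] := position v E3 HE3 v3 vs.
have within1 i' j' z : i'.+1 < size s -> j'.+1 < size s ->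
    z \in [set nth u s i'; nth u s i'.+1] ->
    z \in [set nth u s j'; nth u s j'.+1] -> i' <= j'.+1.
  move=> si' sj' /set2P[]-> /set2P[]/eqP;
    rewrite nth_uniq ?(ltnW si') ?(ltnW sj') // => /eqP.
  - by move->; apply: leqnSn.
  - by move->.
  - by move=> <-; apply/leqW/leqnSn.
  - by case=> ->; apply: leqnSn.
rewrite defE1 in u1 w1 neq12 neq31; rewrite defE2 in u2 v2 neq12 neq23.
rewrite defE3 in v3 w3 neq23 neq31.
have neq_ij : i != j by apply: contraNneq neq12 => ->.
have neq_jk : j != k by apply: contraNneq neq23 => ->.
have neq_ki : k != i by apply: contraNneq neq31 => ->.
move: (within1 _ _ _ si sj u1 u2) (within1 _ _ _ sj si u2 u1).
move: (within1 _ _ _ sj sk v2 v3) (within1 _ _ _ sk sj v3 v2).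
move: (within1 _ _ _ sk si w3 w1) (within1 _ _ _ si sk w1 w3).
by move: neq_ij neq_jk neq_ki; clear; lia.
Qed.

Lemma cut_subgraph_edge (G : sgraph) E : E \in cut_edges G ->
  exists2 E', E' \in edges (cut_subgraph G) & E = [set val u | u in E'].
Proof.
move=> cutE; have /edgesP[a [b [ab defE]]] : E \in edges G.
  by move: cutE; rewrite inE => /andP[].
have coverE c : c \in E -> c \in cover (cut_edges G).
  by move=> cE; apply/bigcupP; exists E.
have [ca cb] : a \in cover (cut_edges G) /\ b \in cover (cut_edges G).
  by rewrite !coverE // defE ?set21 ?set22.
exists [set (Sub a ca : cut_subgraph G); (Sub b cb : cut_subgraph G)].
  by rewrite mem_edges /= /einduced_rel /= ab -defE.
by rewrite imsetU1 imset_set1.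
Qed.

Lemma cut_edges_disjoint_pair (G : sgraph) (E1 E2 E3 : {set G}) :
    linear_forest (cut_subgraph G) ->
    [/\ E1 \in cut_edges G, E2 \in cut_edges G & E3 \in cut_edges G] ->
    [/\ E1 != E2, E2 != E3 & E3 != E1] ->
  [|| [disjoint E1 & E2], [disjoint E2 & E3] | [disjoint E3 & E1]].
Proof.
move=> lin [/cut_subgraph_edge[F1 edgeF1 ->]].
move=> /cut_subgraph_edge[F2 edgeF2 ->] /cut_subgraph_edge[F3 edgeF3 ->].
rewrite !(inj_eq (imset_inj val_inj)) !(imset_disjoint val_inj) => neq.
exact: (linear_forest_disjoint_pair lin (And3 edgeF1 edgeF2 edgeF3) neq).
Qed.

Section SpanningTrees.
Variable G : sgraph.
Implicit Types (x y z u v : G) (p q : seq G) (E : {set G}).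
Implicit Types F T : {set {set G}}.
Hypothesis G_conn : connected G.

Definition spanning F := [forall x, forall y, connect (edge_rel F) x y].

Lemma spanningP F : reflect (forall x y, connect (edge_rel F) x y) (spanning F).
Proof. by apply: (iffP forallP) => F_span x; apply/forallP. Qed.

Definition spanning_tree T := minset spanning T.

Lemma spanning_tree_exists : exists T, spanning_tree T.
Proof.
have [|T treeT] := @ex_minset _ spanning; last by exists T.
by exists setT; apply/spanningP => x y; rewrite connect_edge_relT.
Qed.

Lemma spanning_tree_delete_sep T u v : spanning_tree T -> [set u; v] \in T ->
  ~~ connect (edge_rel (T :\ [set u; v])) u v.
Proof.
move=> /minsetP[/spanningP T_span T_min] uvT; apply/negP => uv.
suff /T_min/(_ (subD1set _ _)) eqT : spanning (T :\ [set u; v]).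
  by move: uvT; rewrite -eqT !inE eqxx.
by apply/spanningP => x y; rewrite eq_connect_edge_rel_delete.
Qed.

Lemma spanning_delete_sides F u v z : spanning F ->
  connect (edge_rel (F :\ [set u; v])) u z \/
  connect (edge_rel (F :\ [set u; v])) v z.
Proof.
move=> /spanningP/(_ u z)/(connect_edge_rel_delete [set u; v]).
case=> [uz|[a [b [eq_ab _ bz]]]]; first by left.
have /set2P[bu|bv] : b \in [set u; v] by rewrite eq_ab set22.
  by left; rewrite bu in bz.
by right; rewrite bv in bz.
Qed.

Lemma non_cut_edge_chord T u v : spanning_tree T -> [set u; v] \in T ->
    adj u v -> [set u; v] \notin cut_edges G ->
  exists a b, [/\ adj a b, [set a; b] \notin T,
                  connect (edge_rel (T :\ [set u; v])) u a &
                  connect (edge_rel (T :\ [set u; v])) v b].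
Proof.
move=> treeT uvT uv; rewrite mem_cut_edges // uv negbK => uv'.
have sep := spanning_tree_delete_sep treeT uvT.
have [a [b [/andP[ab abN] ua ub]]] := connect_leave uv' (connect0 _ u) sep.
rewrite !inE in abN; exists a, b; split=> //.
  apply: contra ub => abT; apply: connect_trans ua (connect1 _).
  by rewrite /= ab !inE abN abT.
have [ub'|//] := spanning_delete_sides u v b (minsetp treeT).
by case/negP: ub.
Qed.

Lemma path_with_one_chord T x y p E : spanning_tree T -> is_path x y p ->
    {subset path_edges x p <= T} ->
    E \in path_edges x p -> E \notin cut_edges G ->
  exists2 q, is_path x y q & count [in ~: T] (path_edges x q) = 1.
Proof.
move=> treeT p_path pT Ep.
have [u [v [defE]]] := path_split_at_edge p_path pT Ep.
set F := T :\ E => xu vy.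
have uvT : [set u; v] \in T by rewrite -defE pT.
have uv : adj u v.
  by rewrite -mem_edges -defE; case: p_path => xp _ _; apply: path_edges_sub Ep.
rewrite defE => /(non_cut_edge_chord treeT uvT uv)[a [b [ab abNT ua vb]]].
have sep := spanning_tree_delete_sep treeT uvT; rewrite -defE -/F in ua vb sep.
have sym := connect_edge_rel_sym F.
have /connect_edge_relP[q1 q1_path q1F] := connect_trans xu ua.
have bv : connect (edge_rel F) b v by rewrite sym.
have /connect_edge_relP[q2 q2_path q2F] := connect_trans bv vy.
have q1_last : last x q1 = a by case: q1_path.
have no_chord z s : {subset path_edges z s <= F} ->
    count [in ~: T] (path_edges z s) = 0.
  move=> sF; apply/eqP; rewrite eqn0Ngt -has_count; apply/hasPn => E' /sF.
  by rewrite !inE => /andP[_ ->].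
exists (q1 ++ b :: q2); last first.
  by rewrite path_edges_cat q1_last count_cat /= !no_chord // inE abNT.
apply: (is_path_cat_edge q1_path ab q2_path); apply/hasPn => z zq2.
apply: contra sep => zq1.
have xz := connect_edge_rel_mem_path q1_path q1F zq1.
have bz := connect_edge_rel_mem_path q2_path q2F zq2.
rewrite sym in xu; rewrite sym in bz.
exact: connect_trans xu (connect_trans xz (connect_trans bz bv)).
Qed.

End SpanningTrees.

Section Colorings.
Variable G : sgraph.
Implicit Types (x y : G) (p q : seq G) (E : {set G}) (B P R T : {set {set G}}).

Lemma conflict_free_path_edge (c : {set G} -> nat) x y :
  conflict_free_path c x [:: y].
Proof. by exists (c [set x; y]); rewrite /= eqxx. Qed.

Definition two_coloring R E : nat := E \in R.

Lemma conflict_free_path_count1 R x p :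
  count [in R] (path_edges x p) = 1 -> conflict_free_path (two_coloring R) x p.
Proof.
move=> count1; exists 1; rewrite -[RHS]count1 count_map; apply: eq_count => E.
by rewrite /= /two_coloring; case: (E \in R).
Qed.

Lemma num_colors_two_coloring R : num_colors (two_coloring R) <= 2.
Proof.
apply: (@uniq_leq_size _ _ [:: 0; 1]); first exact: undup_uniq.
move=> i; rewrite mem_undup => /mapP[E _ ->].
by rewrite /two_coloring; case: (E \in R).
Qed.

Lemma num_colors_gt1 (c : {set G} -> nat) E1 E2 :
  E1 \in edges G -> E2 \in edges G -> c E1 != c E2 -> 1 < num_colors c.
Proof.
move=> edgeE1 edgeE2 neq_c.
apply: (@uniq_leq_size _ [:: c E1; c E2]); first by rewrite /= inE neq_c.
by move=> i; rewrite mem_undup !inE => /orP[]/eqP->; rewrite map_f ?mem_enum.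
Qed.

Lemma conflict_free_path_two_colors (c : {set G} -> nat) x p :
    1 < size p -> conflict_free_path c x p ->
  exists E1 E2,
    [/\ E1 \in path_edges x p, E2 \in path_edges x p & c E1 != c E2].
Proof.
move=> size_p [k count1].
have /mapP[E1 E1p k1] : k \in [seq c E | E <- path_edges x p].
  by rewrite -has_pred1 has_count count1.
have /hasP[E2 E2p neqk] : has (fun E => c E != k) (path_edges x p).
  apply: contraLR size_p => /hasPn all_k; rewrite -leqNgt -count1 count_map.
  rewrite -[size p](size_pairmap (fun u v => [set u; v]) x) -count_predT.
  by apply/eq_leq/eq_in_count => E /all_k; rewrite negbK /= => ->.
by exists E1, E2; rewrite -k1 eq_sym.
Qed.

Lemma cfc_coloring_num_colors_gt1 (c : {set G} -> nat) :
  ~ complete G -> cfc_coloring c -> 1 < num_colors c.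
Proof.
move=> G_ncomp cfc; rewrite ltnNge; apply/negP => one_color.
apply: G_ncomp => x y neq_xy; apply: contraTT one_color => nxy; rewrite -ltnNge.
have [p [[xp up last_p] cf_p]] := cfc x y neq_xy.
have size_p : 1 < size p.
  case: p xp last_p {up cf_p} => [|z [|? p]] //= => [_ eq_xy|/andP[xz _] eq_zy].
    by rewrite eq_xy eqxx in neq_xy.
  by rewrite -eq_zy xz in nxy.
have [E1 [E2 [E1p E2p neq12]]] := conflict_free_path_two_colors size_p cf_p.
by apply: num_colors_gt1 neq12; apply: path_edges_sub xp _ _.
Qed.

Lemma cfc_coloring_spanning_tree T B : connected G -> spanning_tree T ->
    B \subset cut_edges G -> #|B| <= 1 -> trivIset (cut_edges G :\: B) ->
  cfc_coloring (two_coloring (B :|: ~: T)).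
Proof.
move=> G_conn treeT /subsetP cutB card_B disB x y neq_xy.
have /spanningP/(_ x y)/connect_edge_relP[p p_path pT] := minsetp treeT.
have [xp up last_p] := p_path.
have [/hasP[b bp bB]|/hasPn pNB] := boolP (has [in B] (path_edges x p)).
  exists p; split=> //; apply: conflict_free_path_count1.
  have := count_uniq_mem b (path_edges_uniq up); rewrite bp => count1.
  rewrite -[RHS]count1; apply: eq_in_count => E Ep; rewrite /= !inE pT // orbF.
  apply/idP/eqP => [EB|->//]; exact: (card_le1_eqP card_B).
have [/allP p_cut|/allPn[E Ep ENcut]] :=
  boolP (all [in cut_edges G] (path_edges x p)).
  have : size p <= 1.
    by apply: trivIset_path_size disB xp up _ => E Ep; rewrite inE pNB // p_cut.
  case: p p_path {xp up last_p pT pNB p_cut} => [|z [|? ?]] // p_path _.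
    by case: p_path neq_xy => _ _ /= ->; rewrite eqxx.
  by exists [:: z]; split=> //; apply: conflict_free_path_edge.
have [q q_path count1] := path_with_one_chord G_conn treeT p_path pT Ep ENcut.
exists q; split=> //; apply: conflict_free_path_count1; rewrite -[RHS]count1.
apply: eq_in_count => E' E'q; rewrite /= in_setU.
case: (boolP (E' \in B)) => // E'B.
have := cut_edge_on_every_path G_conn (cutB _ E'B) q_path p_path E'q.
by move=> /pNB; rewrite inE E'B.
Qed.

Lemma cfc_number_2 B : connected G -> ~ complete G ->
    B \subset cut_edges G -> #|B| <= 1 -> trivIset (cut_edges G :\: B) ->
  cfc_number_is G 2.
Proof.
move=> G_conn G_ncomp cutB card_B disB.
split=> [|c cfc]; last exact: cfc_coloring_num_colors_gt1.
have [T treeT] := spanning_tree_exists G_conn.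
have cfc := cfc_coloring_spanning_tree G_conn treeT cutB card_B disB.
exists (two_coloring (B :|: ~: T)); split=> //; apply/eqP.
by rewrite eqn_leq num_colors_two_coloring cfc_coloring_num_colors_gt1.
Qed.

End Colorings.

Theorem theorem4p1 (G : sgraph) (n : nat)
  (hn : #|G| = n) (n_ge25 : 25 <= n)
  (G_conn : connected G) (G_ncomp : ~ complete G)
  (C_lin : linear_forest (cut_subgraph G))
  (delta_ge : ((n%:R - 4%:R) / 5%:R <= (min_degree G)%:R :> rat)%R) :
  cfc_number_is G 2.
Proof.
have n_le : n <= min_degree G * 5 + 4.
  move: delta_ge; rewrite Num.Theory.ler_pdivrMr // Num.Theory.lerBlDr.
  by rewrite -GRing.natrM -GRing.natrD Num.Theory.ler_nat.
have card_cut : #|cut_edges G| <= 3.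
  by rewrite -ltnS; apply: card_cut_edges_lt => //; lia.
have [B [cutB card_B disB]] :=
  trivIset_delete_le1 card_cut (fun _ _ _ => cut_edges_disjoint_pair C_lin).
exact: cfc_number_2 cutB card_B disB.
Qed.
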